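(* There exists a positive $f \in \mathcal{A}_{\emptyset}$ which is not CS-positive.
   Context: All graphs are finite and simple; $\emptyset$ denotes the graph with no vertices. A partially labeled graph is a graph in which some vertices carry distinct positive-integer labels. $\mathcal{F}$ is the set of partially labeled graphs up to label-preserving isomorphism, and $\mathcal{F}_L$ those whose label set is exactly the finite set $L\subset\mathbb{N}$. The product $H_1\cdot H_2$ is the disjoint union with equally labeled vertices identified (multiple edges merged). $\mathbb{R}[\mathcal{F}]$ is the algebra of finite formal real linear combinations of elements of $\mathcal{F}$ with this product extended bilinearly, and $\mathbb{R}[\mathcal{F}_L]$ the subalgebra spanned by $\mathcal{F}_L$. For $H\in\mathcal{F}_L$, a graph $G$ and $\phi:L\to V(G)$, $t(H;G,\phi)$ is the probability that the map sending each labeled vertex with label $\ell$ to $\phi(\ell)$ and each unlabeled vertex to an independent uniform random vertex of $G$ is a homomorphism; this is extended linearly. Let $\mathcal{K}$ be the ideal generated by $F-\emptyset$ for $F$ a one-vertex (labeled or unlabeled) graph; $\mathcal{A}=\mathbb{R}[\mathcal{F}]/\mathcal{K}$, $\mathcal{A}_L=\mathbb{R}[\mathcal{F}_L]/(\mathcal{K}\cap\mathbb{R}[\mathcal{F}_L])$. An element $f\in\mathcal{A}_L$ is positive if $t(f;G,\phi)\ge0$ for all graphs $G$ and all $\phi:L\to V(G)$. For finite $T\subset\mathbb{N}$, $\llbracket\cdot\rrbracket_T$ is the linear map removing all labels not in $T$. The Cauchy-Schwarz calculus operates with statements $f\ge0$, $f\in\mathcal{A}$, with axioms (A1) $f^2\ge0$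 for every $f\in\mathcal{A}$; (A2) $\llbracket f_1^2\rrbracket_T\llbracket f_2^2\rrbracket_T-\llbracket f_1f_2\rrbracket_T^2\ge0$ for every finite $L\subset\mathbb{N}$, $f_1,f_2\in\mathcal{A}_L$ and $T\subseteq L$; and inference rules (R1) from $f\ge0$ and $g\ge0$ infer $\alpha f+\beta g\ge0$ for $\alpha,\beta\ge0$; (R2) from $f\ge0$ and $g\ge0$ infer $fg\ge0$; (R3) from $f\ge0$ infer $\llbracket f\rrbracket_T\ge0$ for any finite $T\subseteq\mathbb{N}$. An element $f\in\mathcal{A}$ is CS-positive if $f\ge0$ is provable in this calculus. *)

(* Defs.v *)
From HB Require Import structures.
From mathcomp Require Import all_boot all_order all_algebra.
From Stdlib Require Reals.
From mathcomp Require Import boolp Rstruct.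
Notation R := Rdefinitions.R.
Set Implicit Arguments. Unset Strict Implicit. Unset Printing Implicit Defensive.
Import Order.TTheory GRing.Theory Num.Theory.
Local Open Scope ring_scope.

(* A partially labeled graph H has labeled vertices  inl l  for l \in plL H  *)
(* (so distinct labeled vertices carry distinct labels, automatically), and  *)
(* unlabeled vertices  inr i  for i < plU H.  The edge relation plE is an    *)
(* arbitrary boolean relation on nat + nat; only its symmetric, irreflexive  *)
(* restriction to valid vertices ([sedge]) is meaningful, so every H denotes *)
(* a finite simple partially labeled graph, and every such graph arises.     *)
(* Labels are natural numbers (the label l here plays the role of the        *)
(* positive integer l+1 of the paper; this relabeling is immaterial).        *)
Record plg := PLG { plL : seq nat; plU : nat; plE : rel (nat + nat) }.

Definition valid (H : plg) (x : nat + nat) : bool :=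
  match x with inl l => l \in plL H | inr i => (i < plU H)%N end.

Definition sedge (H : plg) (x y : nat + nat) : bool :=
  [&& valid H x, valid H y, x != y & plE H x y || plE H y x].

Definition gempty : plg := PLG [::] 0 (fun _ _ => false).

Definition one_vertex (F : plg) : bool := (size (undup (plL F)) + plU F == 1)%N.

Definition pl_iso (H H' : plg) : Prop :=
  plL H =i plL H' /\
  exists s : 'I_(plU H) -> 'I_(plU H'), bijective s /\
    let m x := match x with
               | inl l => inl l
               | inr i => if (insub i : option 'I_(plU H)) is Some j
                          then inr (nat_of_ord (s j)) else inr i end in
    forall x y, valid H x -> valid H y -> sedge H x y = sedge H' (m x) (m y).

(* product: disjoint union, equally labeled vertices identified *)
Definition plmul (H1 H2 : plg) : plg :=
  let U1 := plU H1 in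
  let sh (x : nat + nat) : option (nat + nat) :=
    match x with
    | inl l => Some (inl l)
    | inr i => if (U1 <= i)%N then Some (inr (i - U1)%N) else None end in
  PLG (plL H1 ++ plL H2) (U1 + plU H2)
      (fun x y => sedge H1 x y ||
         match sh x, sh y with Some a, Some b => sedge H2 a b | _, _ => false end).

Definition plunl (T : seq nat) (H : plg) : plg :=
  let r := [seq l <- undup (plL H) | l \notin T] in
  let U := plU H in
  let back (x : nat + nat) : nat + nat :=
    match x with
    | inl l => inl l
    | inr i => if (i < U)%N then inr i else inl (nth 0%N r (i - U)) end in
  PLG [seq l <- plL H | l \in T] (U + size r)
      (fun x y => sedge H (back x) (back y)).

(* Formal real linear combinations: elements of R[F] (representatives).     *)
Definition comb := seq (R * plg)%type.

Definition addA (f g : comb) : comb := f ++ g.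
Definition scaleA (a : R) (f : comb) : comb := [seq (a * p.1, p.2) | p <- f].
Definition subA (f g : comb) : comb := f ++ scaleA (-1) g.
Definition mulA (f g : comb) : comb :=
  [seq (p.1 * q.1, plmul p.2 q.2) | p <- f, q <- g].
Definition unlA (T : seq nat) (f : comb) : comb := [seq (p.1, plunl T p.2) | p <- f].

(* f is the zero element of R[F] (coefficients of each isomorphism class sum to 0) *)
Definition zeroF (f : comb) : Prop :=
  forall H : plg, \sum_(p <- f) (if `[< pl_iso p.2 H >] then p.1 else 0) = 0.

(* membership in the ideal K generated by F - emptyset, F one-vertex *)
Definition inK (f : comb) : Prop :=
  exists gens : seq (R * plg * plg),
    all (fun g => one_vertex g.2) gens /\
    zeroF (subA f (flatten [seq [:: (g.1.1, plmul g.1.2 g.2); (- g.1.1, g.1.2)]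
                           | g <- gens])).

(* equality in A = R[F]/K *)
Definition eqA (f g : comb) : Prop := inK (subA f g).

Definition sameset (a b : seq nat) : bool := all (mem b) a && all (mem a) b.
Definition inFL (L : seq nat) (f : comb) : bool := all (fun p => sameset (plL p.2) L) f.

(* Homomorphism densities t(H; G, phi).  G is a graph on 'I_n.+1 (graphs     *)
(* with at least one vertex) with symmetric irreflexive adjacency g;        *)
(* phi : nat -> V(G) (only its values on the labels matter).                *)
Definition assign (H : plg) n (phi : nat -> 'I_n.+1)
  (psi : {ffun 'I_(plU H) -> 'I_n.+1}) (x : nat + nat) : 'I_n.+1 :=
  match x with
  | inl l => phi l
  | inr i => if (insub i : option 'I_(plU H)) is Some j then psi j else ord0
  end.

Definition is_hom (H : plg) n (g : rel 'I_n.+1) (phi : nat -> 'I_n.+1)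
  (psi : {ffun 'I_(plU H) -> 'I_n.+1}) : Prop :=
  forall x y, sedge H x y -> g (assign phi psi x) (assign phi psi y).

Definition tH (H : plg) n (g : rel 'I_n.+1) (phi : nat -> 'I_n.+1) : R :=
  (#|[set psi : {ffun 'I_(plU H) -> 'I_n.+1} | `[< is_hom g phi psi >] ]|)%:R
  / ((n.+1) ^ (plU H))%:R.

Definition tA (f : comb) n (g : rel 'I_n.+1) (phi : nat -> 'I_n.+1) : R :=
  \sum_(p <- f) p.1 * tH p.2 g phi.

Definition positive (f : comb) : Prop :=
  forall n (g : rel 'I_n.+1), symmetric g -> irreflexive g ->
  forall phi : nat -> 'I_n.+1, 0 <= tA f g phi.

(* The Cauchy-Schwarz calculus.  CS f  means  "f >= 0" is provable; since   *)
(* statements are about elements of A, provability is closed under eqA.     *)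
Inductive CS : comb -> Prop :=
| CS_eq f g : CS f -> eqA f g -> CS g
| CS_A1 f : CS (mulA f f)
| CS_A2 (L T : seq nat) (f1 f2 : comb) :
    inFL L f1 -> inFL L f2 -> {subset T <= L} ->
    CS (subA (mulA (unlA T (mulA f1 f1)) (unlA T (mulA f2 f2)))
             (mulA (unlA T (mulA f1 f2)) (unlA T (mulA f1 f2))))
| CS_R1 f g (a b : R) : 0 <= a -> 0 <= b -> CS f -> CS g ->
    CS (addA (scaleA a f) (scaleA b g))
| CS_R2 f g : CS f -> CS g -> CS (mulA f g)
| CS_R3 (T : seq nat) f : CS f -> CS (unlA T f).

Definition CS_positive (f : comb) : Prop := CS f.

(* Main.v *)
(* A graph whose vertices carry weights of total mass 1 in a commutative ring  *)
(* assigns to every f in A, and every placement of the labels, a value in that *)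
(* ring.  Take as ring R[y][x][s] and weights of the form c + s * l with c a   *)
(* positive constant.  Squares are squares, removing labels is a weighted sum, *)
(* and (A2) is Lagrange's identity, so every CS-positive element evaluates to  *)
(* a sum of squares whose weights are positive constants at s = 0.  The lowest *)
(* coefficient in s of such a sum is a sum of squares in R[x, y].              *)
(*                                                                             *)
(* On four looped, pairwise nonadjacent vertices the star densities are the    *)
(* power sums of the weights, and the l's can be chosen so that three centered *)
(* star densities are s * x, s * y and s up to O(s^2).  The Motzkin form of    *)
(* these three densities is nonnegative on every graph, but its lowest         *)
(* coefficient is the Motzkin polynomial, which is not a sum of squares.       *)

Require Import Defs.
From HB Require Import structures.
From mathcomp Require Import all_boot all_order all_algebra.
From Stdlib Require Reals.
From mathcomp Require Import boolp Rstruct.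
From mathcomp Require Import ring lra zify.
(* Again, because all_algebra shadows [addA]. *)
Import Defs.

Set Implicit Arguments.
Unset Strict Implicit.
Unset Printing Implicit Defensive.

Import Order.TTheory GRing.Theory Num.Theory.
Local Open Scope ring_scope.

(** * Weighted averages over assignments *)

(** The witness [motzkin_star] is positive because the Motzkin form is nonnegative at all real
    arguments ([motzkin_ge0]), whatever the three densities are. Provability is refuted by a model
    that no ordinary graph gives: weights containing indeterminates. Evaluation respects products,
    the quotient by K and label removal ([evA_mul], [evA_eqA], [evA_unl]), so [CS_sound] turns a
    derivation into a weighted sum of squares. In R[y][x][s] each of the three centered densities is
    divisible by s. The form is homogeneous of degree 6, hence the value of the witness is s^6 G,
    where G at s = 0 is the Motzkin polynomial ([motzkin_star_order6]). Since R[y][x] is formally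
    real, no cancellation occurs among squares at s = 0, and G at s = 0 would be a sum of squares
    ([wsos_lowest]), against [motzkin_not_sos]. *)

Section Average.
Variables (B : comNzRingType) (V : finType) (w : V -> B).

Definition avg (I : finType) (F : {ffun I -> V} -> B) : B :=
  \sum_(chi : {ffun I -> V}) (\prod_i w (chi i)) * F chi.

Lemma eq_avg (I : finType) (F G : {ffun I -> V} -> B) :
  F =1 G -> avg F = avg G.
Proof. by move=> FG; apply: eq_bigr => chi _; rewrite FG. Qed.

Lemma avgZ (I : finType) (F : {ffun I -> V} -> B) (b : B) :
  avg (fun chi => b * F chi) = b * avg F.
Proof. by rewrite /avg mulr_sumr; apply: eq_bigr => chi _; rewrite mulrCA. Qed.

Lemma avgD (I : finType) (F G : {ffun I -> V} -> B) :
  avg (fun chi => F chi + G chi) = avg F + avg G.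
Proof. by rewrite /avg -big_split; apply: eq_bigr => chi _; rewrite mulrDr. Qed.

Lemma avg_sumType (I J : finType) (F : {ffun I + J -> V} -> B) :
  avg F = avg (fun chi1 : {ffun I -> V} => avg (fun chi2 : {ffun J -> V} =>
    F [ffun k => match k with inl i => chi1 i | inr j => chi2 j end])).
Proof.
transitivity (\sum_(p : {ffun I -> V} * {ffun J -> V})
  (\prod_i w (p.1 i)) * ((\prod_j w (p.2 j)) *
    F [ffun k => match k with inl i => p.1 i | inr j => p.2 j end])); last first.
  rewrite -(pair_bigA _ (fun (c1 : {ffun I -> V}) (c2 : {ffun J -> V}) =>
    (\prod_i w (c1 i)) * ((\prod_j w (c2 j)) *
    F [ffun k => match k with inl i => c1 i | inr j => c2 j end]))) /=.
  by apply: eq_bigr => c1 _; rewrite -mulr_sumr.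
rewrite /avg (reindex (fun p : {ffun I -> V} * {ffun J -> V} =>
  [ffun k : I + J => match k with inl i => p.1 i | inr j => p.2 j end])) /=.
  apply: eq_bigr => -[c1 c2] _ /=; rewrite big_sumType /= -mulrA.
  by congr (_ * (_ * _)); apply: eq_bigr => k _; rewrite ffunE.
exists (fun c : {ffun I + J -> V} =>
  ([ffun i => c (inl i)], [ffun j => c (inr j)])) => [[c1 c2] _ | c _].
  by congr pair; apply/ffunP => k; rewrite !ffunE.
by apply/ffunP => -[k|k]; rewrite !ffunE.
Qed.

Hypothesis w1 : \sum_v w v = 1.

(** Coordinates outside the image of [e] sum out to total mass 1. *)
Lemma avg_marginal (I J : finType) (e : J -> I) (F : {ffun J -> V} -> B) :
  injective e -> avg (fun chi : {ffun I -> V} => F [ffun j => chi (e j)]) = avg F.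
Proof.
move=> inj_e; rewrite /avg.
rewrite (partition_big (fun chi : {ffun I -> V} => [ffun j => chi (e j)]) xpredT) //=.
apply: eq_bigr => xi _.
under eq_bigr => chi /eqP E do rewrite E.
rewrite -mulr_suml; congr (_ * _).
(* [P i v] allows the value [v] at [i]. The condition is coordinatewise, so the sum over a fibre is
   a product of sums; off the image of [e] every value is allowed. *)
pose P i v := [forall j, (e j == i) ==> (v == xi j)].
transitivity (\prod_i \sum_(v | P i v) w v).
  under [RHS]eq_bigr do rewrite big_mkcond.
  rewrite bigA_distr_bigA big_mkcond /=; apply: eq_bigr => chi _.
  case: eqP => [E|ne].
    apply: eq_bigr => i _; case: ifP => // /negP[].
    by apply/forallP => j; apply/implyP => /eqP <-; rewrite -E ffunE.
  have [j nj] : exists j, chi (e j) != xi j.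
    apply/existsP; apply: contra_notT ne => /existsPn ne; apply/ffunP => j.
    by rewrite ffunE; apply/eqP; move: (ne j); rewrite negbK.
  rewrite (bigD1 (e j)) //= ifN ?mul0r //.
  by apply/forallPn; exists j; rewrite eqxx.
rewrite (bigID (mem (e @: [set: J]))) /= [X in _ * X]big1 ?mulr1; last first.
  move=> i /negP ni; rewrite -[RHS]w1; apply: eq_bigl => v.
  by apply/forallP => j; apply/implyP => /eqP ji; case: ni; rewrite -ji imset_f.
rewrite big_imset /=; last by move=> ? ? _ _; apply: inj_e.
rewrite big_set /=; apply: eq_bigr => j _.
rewrite (big_pred1 (xi j)) // => v /=.
apply/forallP/eqP => [/(_ j)|-> k]; first by rewrite eqxx => /eqP.
by apply/implyP => /eqP /inj_e ->.
Qed.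

Lemma avg_cst (I : finType) (b : B) : avg (fun _ : {ffun I -> V} => b) = b.
Proof.
rewrite /avg -mulr_suml -(bigA_distr_bigA (fun _ : I => w)) big1 ?mul1r //.
Qed.

End Average.

(** * Evaluation in a weighted graph *)

(** The local function [m] of [pl_iso], named so that [pl_isoP] holds by conversion. *)
Definition relabel (H H' : plg) (s : 'I_(plU H) -> 'I_(plU H')) (x : nat + nat) :=
  match x with
  | inl l => inl l
  | inr i => if (insub i : option 'I_(plU H)) is Some j
             then inr (nat_of_ord (s j)) else inr i
  end.

Lemma relabel_valid H H' (s : 'I_(plU H) -> 'I_(plU H')) x :
  plL H =i plL H' -> valid H x -> valid H' (relabel s x).
Proof.
case: x => [l|i] /= E; first by rewrite E.
by move=> lti; rewrite insubT /= ltn_ord.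
Qed.

Lemma relabelK H H' (s : 'I_(plU H) -> 'I_(plU H')) t x :
  cancel s t -> valid H x -> relabel t (relabel s x) = x.
Proof.
by case: x => [l|i] //= K lti; rewrite insubT /= valK K.
Qed.

Lemma relabel_comp H1 H2 H3 (s : 'I_(plU H1) -> 'I_(plU H2))
    (t : 'I_(plU H2) -> 'I_(plU H3)) x :
  valid H1 x -> relabel t (relabel s x) = relabel (t \o s) x.
Proof. by case: x => [l|i] //= lti; rewrite insubT /= valK. Qed.

Lemma pl_isoP H H' : pl_iso H H' <->
  plL H =i plL H' /\ exists s : 'I_(plU H) -> 'I_(plU H'), bijective s /\
    forall x y, valid H x -> valid H y ->
      sedge H x y = sedge H' (relabel s x) (relabel s y).
Proof. by []. Qed.

Lemma pl_iso_refl H : pl_iso H H.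
Proof.
apply/pl_isoP; split=> //; exists id; split; first by exists id.
have E x : valid H x -> relabel (@id 'I_(plU H)) x = x.
  by case: x => [l|i] //= lti; rewrite insubT.
by move=> x y vx vy; rewrite !E.
Qed.

Lemma pl_iso_sym H H' : pl_iso H H' -> pl_iso H' H.
Proof.
move=> /pl_isoP[EL [s [[t sK tK] Es]]]; apply/pl_isoP; split=> //.
exists t; split; first by exists s.
move=> x y vx vy; have EL' : plL H' =i plL H by [].
by rewrite Es ?relabel_valid // !relabelK.
Qed.

Lemma pl_iso_trans H1 H2 H3 : pl_iso H1 H2 -> pl_iso H2 H3 -> pl_iso H1 H3.
Proof.
move=> /pl_isoP[EL [s [bs Es]]] /pl_isoP[EL' [t [bt Et]]]; apply/pl_isoP.
split; first by move=> l; rewrite EL.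
exists (t \o s); split; first exact: bij_comp.
by move=> x y vx vy; rewrite Es // Et ?relabel_valid // !relabel_comp.
Qed.

Lemma sedge_valid H x y : sedge H x y -> valid H x /\ valid H y.
Proof. by case/and4P. Qed.

Section Evaluation.
Variables (B : comNzRingType) (iota : {rmorphism R -> B}).
Variables (n : nat) (g : rel 'I_n.+1) (w : 'I_n.+1 -> B).
Implicit Types (phi : nat -> 'I_n.+1) (f : comb).

Definition homb H (rho : nat + nat -> 'I_n.+1) : bool :=
  `[< forall x y, sedge H x y -> g (rho x) (rho y) >].

(** The relation [g] may have loops. Uniform real weights give back [tH] ([tH_ev]); the refuting
    model takes [eq_op]. *)
Definition ev H phi : B :=
  avg w (fun psi : {ffun 'I_(plU H) -> 'I_n.+1} => (homb H (assign phi psi))%:R).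

Definition evA f phi : B := \sum_(p <- f) iota p.1 * ev p.2 phi.

Lemma evA_add f1 f2 phi : evA (addA f1 f2) phi = evA f1 phi + evA f2 phi.
Proof. by rewrite /evA big_cat. Qed.

Lemma evA_scale a f phi : evA (scaleA a f) phi = iota a * evA f phi.
Proof.
rewrite /evA big_map mulr_sumr; apply: eq_bigr => p _.
by rewrite rmorphM mulrA.
Qed.

Lemma evA_sub f1 f2 phi : evA (subA f1 f2) phi = evA f1 phi - evA f2 phi.
Proof.
by rewrite -[subA _ _]/(addA _ _) evA_add evA_scale rmorphN1 mulN1r.
Qed.

Hypothesis w1 : \sum_v w v = 1.

Lemma ev_iso H H' phi : pl_iso H H' -> ev H phi = ev H' phi.
Proof.
move=> /pl_isoP[EL [s [[t sK tK] Es]]].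
rewrite /ev -(avg_marginal w1 _ (can_inj sK)); apply: eq_avg => chi.
congr (_%:R); congr nat_of_bool.
have EL' : plL H' =i plL H by [].
have A x : valid H x -> assign phi [ffun j => chi (s j)] x = assign phi chi (relabel s x).
  by case: x => [l|i] //= lti; rewrite !insubT /= ffunE valK.
apply/asboolP/asboolP => h x y xy; have [vx vy] := sedge_valid xy.
  rewrite -(relabelK tK vx) -(relabelK tK vy) -!A ?relabel_valid //; apply: h.
  by rewrite Es ?relabel_valid // !relabelK.
by rewrite !A //; apply: h; rewrite -Es.
Qed.

(** Induction on length: [ev] is constant on the isomorphism class of the first graph, whose
    coefficients sum to 0, and deleting that class leaves a zero combination. *)
Lemma zeroF_ev f phi : zeroF f -> evA f phi = 0.
Proof.
have [k] := ubnP (size f); elim: k f => // k IH [|[a H] f] ltk z.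
  by rewrite /evA big_nil.
pose P (p : R * plg) := `[< pl_iso p.2 H >].
have PH : P (a, H) by apply/asboolP; exact: pl_iso_refl.
rewrite /evA (bigID P) /= [X in X + _](_ : _ = 0) ?add0r; last first.
  rewrite (eq_bigr (fun p => iota p.1 * ev H phi)); last first.
    by move=> p /asboolP /ev_iso ->.
  rewrite -mulr_suml -rmorph_sum /= big_mkcond /=.
  by rewrite (z H) rmorph0 mul0r.
rewrite -big_filter /= PH /=; apply: IH.
  by rewrite size_filter; apply: leq_ltn_trans (count_size _ _) _; rewrite -ltnS.
move=> H'; rewrite big_filter.
have [HH'|nHH'] := pselect (pl_iso H H').
  rewrite big1 // => p /asboolP np; case: asboolP => // pH'; case: np.
  exact: pl_iso_trans pH' (pl_iso_sym HH').
have := z H'; rewrite (bigID P) /= [X in X + _]big1 ?add0r; last first.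
  move=> p /asboolP pH; case: asboolP => // pH'; case: nHH'.
  exact: pl_iso_trans (pl_iso_sym pH) pH'.
by rewrite big_cons PH.
Qed.

Lemma ev_mul H1 H2 phi : ev (plmul H1 H2) phi = ev H1 phi * ev H2 phi.
Proof.
rewrite /ev /= -(avg_marginal w1 _ (can_inj (@splitK (plU H1) (plU H2)))).
rewrite avg_sumType mulrC -avgZ; apply: eq_avg => chi1.
rewrite mulrC -avgZ; apply: eq_avg => chi2.
rewrite -natrM mulnb; congr (_%:R); congr nat_of_bool.
set rho := assign _ _.
have rhol i (lti : (i < plU H1)%N) : rho (inr i) = chi1 (Ordinal lti).
  rewrite /rho /assign insubT /= ?ltn_addr // => lt'.
  rewrite !ffunE (_ : Sub i lt' = lshift _ (Ordinal lti)); last exact: val_inj.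
  by rewrite (unsplitK (inl _)).
have rhor i (lti : (i < plU H2)%N) : rho (inr (plU H1 + i)%N) = chi2 (Ordinal lti).
  rewrite /rho /assign insubT /= ?ltn_add2l // => lt'.
  rewrite !ffunE (_ : Sub (plU H1 + i)%N lt' = rshift (plU H1) (Ordinal lti)); last exact: val_inj.
  by rewrite (unsplitK (inr _)).
(* The embedding of [H2] into the product shifts unlabeled vertices past those of [H1] and fixes
   labels. *)
pose up (x : nat + nat) : nat + nat :=
  match x with inl l => inl l | inr i => inr (plU H1 + i)%N end.
have A1 x : valid H1 x -> assign phi chi1 x = rho x.
  by case: x => [l|i] // lti; rewrite (rhol _ lti) /= insubT.
have A2 x : valid H2 x -> assign phi chi2 x = rho (up x).
  by case: x => [l|i] // lti; rewrite (rhor _ lti) /= insubT.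
have V1 x : valid H1 x -> valid (plmul H1 H2) x.
  by case: x => [l|i] /=; [rewrite mem_cat => -> | apply: ltn_addr].
have V2 x : valid H2 x -> valid (plmul H1 H2) (up x).
  by case: x => [l|i] /=; [rewrite mem_cat orbC => -> | rewrite ltn_add2l].
apply/asboolP/andP => [h|[/asboolP h1 /asboolP h2] x y].
  split; apply/asboolP => x y xy; have [vx vy] := sedge_valid xy.
    rewrite !A1 //; apply: h; move: (xy) => /and4P[_ _ nxy _].
    by rewrite /sedge !V1 // nxy /= xy.
  rewrite !A2 //; apply: h; move: (xy) => /and4P[_ _ nxy _].
  rewrite /sedge !V2 //=; apply/andP; split.
    case: x y nxy {xy vx vy} => [l|i] [l'|j] //=.
    by apply: contraNN => /eqP[] /addnI ->.
  apply/orP; left; apply/orP; right.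
  by case: x y xy {nxy vx vy} => [l|i] [l'|j] /=; rewrite ?leq_addr ?addKn.
have half u v : plE (plmul H1 H2) u v -> g (rho u) (rho v) /\ g (rho v) (rho u).
  have sym H a b : sedge H a b = sedge H b a.
    by rewrite /sedge eq_sym andbCA orbC.
  move=> /orP[e|].
    have [vu vv] := sedge_valid e.
    by rewrite -!A1 //; split; apply: h1 => //; rewrite sym.
  case: u v => [l|i] [l'|j].
  - move=> e; have [vu vv] := sedge_valid e.
    by rewrite -[inl l]/(up (inl l)) -[inl l']/(up (inl l')) -!A2 //;
      split; apply: h2 => //; rewrite sym.
  - case: leqP => // le e; have [vu vv] := sedge_valid e.
    by rewrite -[inl l]/(up (inl l)) -(subnKC le) -[inr (_ + _)%N]/(up (inr _)) -!A2 //;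
      split; apply: h2 => //; rewrite sym.
  - case: leqP => // le e; have [vu vv] := sedge_valid e.
    by rewrite -[inl l']/(up (inl l')) -(subnKC le) -[inr (_ + _)%N]/(up (inr _)) -!A2 //;
      split; apply: h2 => //; rewrite sym.
  - case: leqP => // le; case: leqP => // le' e; have [vu vv] := sedge_valid e.
    rewrite -(subnKC le) -(subnKC le') -![inr (_ + _)%N]/(up (inr _)) -!A2 //.
    by split; apply: h2 => //; rewrite sym.
by case/and4P => _ _ _ /orP[] /half [].
Qed.

Lemma evA_mul f1 f2 phi : evA (mulA f1 f2) phi = evA f1 phi * evA f2 phi.
Proof.
rewrite /evA /mulA big_allpairs_dep /= mulr_suml; apply: eq_bigr => p _.
rewrite mulr_sumr; apply: eq_bigr => q _.
by rewrite ev_mul rmorphM mulrACA.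
Qed.

(** There is no edge to preserve, and the total mass is 1. This is why evaluation factors through
    the quotient by K. *)
Lemma ev_one_vertex H phi : one_vertex H -> ev H phi = 1.
Proof.
move=> H1; rewrite /ev -[RHS](avg_cst w1 'I_(plU H)); apply: eq_avg => psi.
suff -> : homb H (assign phi psi) by [].
apply/asboolP => x y /and4P[vx vy nxy _]; exfalso; move: H1.
have U0 i : (i < plU H)%N -> (0 < plU H)%N by apply: leq_ltn_trans.
have L0 l : l \in plL H -> (0 < @size nat (undup (plL H)))%N.
  by rewrite -mem_undup; case: undup.
rewrite /one_vertex; case: x y vx vy nxy => [l|i] [l'|j] /= vx vy nxy.
- have: (size [:: l; l'] <= @size nat (undup (plL H)))%N.
    apply: uniq_leq_size; first by rewrite /= inE andbT.
    by move=> k; rewrite !inE mem_undup => /orP[] /eqP ->.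
  by rewrite /=; lia.
- by have := U0 _ vy; have := L0 _ vx; lia.
- by have := U0 _ vx; have := L0 _ vy; lia.
- have : i != j by apply: contraNneq nxy => ->.
  by lia.
Qed.

Lemma evA_eqA f1 f2 phi : eqA f1 f2 -> evA f1 phi = evA f2 phi.
Proof.
move=> [gens [all1 /(@zeroF_ev _ phi)]].
rewrite !evA_sub => /eqP; rewrite subr_eq0 => /eqP E.
apply/eqP; rewrite -subr_eq0 E; apply/eqP.
elim: gens all1 {E} => [_|h gens IH /= /andP[h1 hs]]; first by rewrite /evA big_nil.
rewrite /evA !big_cons /= -/(evA _ phi) IH // ev_mul (ev_one_vertex _ h1).
by rewrite rmorphN; ring.
Qed.

(* Labels outside [T] are resampled; those not below [N] are left alone, so   *)
(* [N] must exceed every label in use.                                        *)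
Definition resample (T : seq nat) N (phi : nat -> 'I_n.+1)
    (chi : {ffun 'I_N -> 'I_n.+1}) (l : nat) : 'I_n.+1 :=
  if l \in T then phi l else
  if (insub l : option 'I_N) is Some j then chi j else phi l.

Lemma ev_unl T N H phi : all (fun l => l < N)%N (plL H) ->
  ev (plunl T H) phi = avg w (fun chi : {ffun 'I_N -> _} => ev H (resample T phi chi)).
Proof.
move=> /allP LN; set r := [seq l <- undup (plL H) | l \notin T].
have rN j : (j < size r)%N -> (nth 0%N r j < N)%N.
  by move=> /(mem_nth 0%N); rewrite mem_filter mem_undup => /andP[_ /LN].
have ur : uniq r by rewrite filter_uniq ?undup_uniq.
(* The new unlabeled vertices are the old ones and the erased labels; an erased label uses the
   coordinate of [chi] that it indexes. *)
pose e (k : 'I_(plU (plunl T H))) : 'I_N + 'I_(plU H) :=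
  match split (k : 'I_(plU H + size r)) with
  | inl i => inr i
  | inr j => inl (Ordinal (rN j (ltn_ord j)))
  end.
have inj_e : injective e.
  move=> k k'; rewrite /e => E; apply: (can_inj (@splitK _ _)); move: E.
  case: (split k) (split k') => [i|j] [i'|j'] //= [] => [->|/eqP] //.
  by rewrite nth_uniq ?ltn_ord // => /eqP E; congr inr; apply: val_inj.
rewrite /ev -(avg_marginal w1 _ inj_e) avg_sumType; apply: eq_avg => chi.
apply: eq_avg => psi; congr (_%:R); congr nat_of_bool.
set rho := assign _ _.
pose back (x : nat + nat) : nat + nat :=
    match x with
    | inl l => inl l
    | inr i => if (i < plU H)%N then inr i else inl (nth 0%N r (i - plU H)) end.
pose forth (x : nat + nat) : nat + nat :=
    match x with
    | inl l => if l \in T then inl l else inr (plU H + index l r)%N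
    | inr i => inr i end.
have A x : valid (plunl T H) x -> rho x = assign (resample T phi chi) psi (back x).
  case: x => [l|i] /=.
    by rewrite mem_filter /resample => /andP[-> _].
  move=> lti; rewrite insubT /= !ffunE /e.
  case: (splitP (Sub i lti)) => /= j Ej.
    by rewrite Ej valK.
  have jr : nth 0%N r j \in r by rewrite mem_nth.
  have nT : nth 0%N r j \notin T by move: jr; rewrite mem_filter => /andP[].
  rewrite Ej addKn /resample (negbTE nT) insubT ?rN //= => lt'.
  by congr (chi _); apply: val_inj.
have fv x : valid H x -> valid (plunl T H) (forth x).
  case: x => [l|i] /=; last by move=> ?; apply: ltn_addr.
  case: ifP => lT lH /=; first by rewrite mem_filter lT.
  by rewrite ltn_add2l index_mem mem_filter lT mem_undup.
have fK x : valid H x -> back (forth x) = x.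
  case: x => [l|i] /=; last by move=> ->.
  case: ifP => lT lH //=; rewrite ltnNge leq_addr /= addKn nth_index //.
  by rewrite mem_filter lT mem_undup.
apply/asboolP/asboolP => h x y xy; have [vx vy] := sedge_valid xy.
  have := h (forth x) (forth y); rewrite !A ?fv // !fK //; apply.
  move: (xy) => /and4P[_ _ nxy _]; rewrite /sedge !fv //=.
  apply/andP; split; first by apply: contraNneq nxy => E; rewrite -(fK x) // -(fK y) // E.
  by apply/orP; left; rewrite -/(back _) -/(back _) !fK.
rewrite !A //; move: xy => /and4P[_ _ _ /orP[]] e'; first exact: (h _ _ e').
apply: h; move: e'; rewrite /= -/(back y) -/(back x).
by rewrite /sedge eq_sym andbCA orbC.
Qed.

Definition label_bound f : nat := \max_(p <- f) \max_(l <- plL p.2) l.+1.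

Lemma evA_unl T N f phi : (label_bound f <= N)%N ->
  evA (unlA T f) phi = avg w (fun chi : {ffun 'I_N -> _} => evA f (resample T phi chi)).
Proof.
elim: f => [|p f IH] fN.
  by rewrite /evA big_nil; under eq_avg do rewrite big_nil; rewrite avg_cst.
move: fN; rewrite /label_bound big_cons geq_max => /andP[pN fN].
rewrite /evA /= big_cons /= -/(evA _ phi) IH //.
under [RHS]eq_avg do rewrite big_cons.
rewrite avgD avgZ -ev_unl //.
apply/allP => l lp; apply: leq_trans pN.
by rewrite (big_rem l) //= leq_maxl.
Qed.

End Evaluation.
(** * Soundness of the calculus for weighted sums of squares *)

Section Soundness.
Variables (B : comNzRingType) (iota : {rmorphism R -> B}) (pos : B -> Prop).
Hypothesis posM : forall a b, pos a -> pos b -> pos (a * b).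
Hypothesis pos_iota : forall a : R, 0 < a -> pos (iota a).

(** Weights stay separate from squares: a vertex weight c + s l is in general no sum of squares. *)
Inductive wsos : B -> Prop :=
| wsos0 : wsos 0
| wsos_cons m g F : pos m -> wsos F -> wsos (m * g ^+ 2 + F).

Lemma wsosD F G : wsos F -> wsos G -> wsos (F + G).
Proof.
elim=> [|m g F' pm _ IH] sG; first by rewrite add0r.
by rewrite -addrA; apply: wsos_cons => //; exact: IH.
Qed.

Lemma wsos_sqr g : wsos (g ^+ 2).
Proof.
rewrite -[_ ^+ 2]addr0 -[_ ^+ 2]mul1r -(rmorph1 iota).
by apply: wsos_cons wsos0; apply: pos_iota; exact: ltr01.
Qed.

Lemma wsosZ m F : pos m -> wsos F -> wsos (m * F).
Proof.
move=> pm; elim=> [|m' g F' pm' _ IH]; first by rewrite mulr0; exact: wsos0.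
by rewrite mulrDr mulrA; apply: wsos_cons => //; exact: posM.
Qed.

Lemma wsosM F G : wsos F -> wsos G -> wsos (F * G).
Proof.
move=> sF sG; elim: sF => [|m g F' pm _ IH]; first by rewrite mul0r; exact: wsos0.
rewrite mulrDl -mulrA; apply: wsosD (IH); apply: wsosZ => //.
elim: sG => [|m' g' G' pm' _ IH']; first by rewrite mulr0; exact: wsos0.
by rewrite mulrDr mulrCA -exprMn; apply: wsos_cons.
Qed.

Lemma wsos_scale (a : R) F : 0 <= a -> wsos F -> wsos (iota a * F).
Proof.
rewrite le_eqVlt => /predU1P[<- _|a0]; last by apply: wsosZ; exact: pos_iota.
by rewrite rmorph0 mul0r; exact: wsos0.
Qed.

Lemma wsos_sum (I : finType) (F : I -> B) :
  (forall i, wsos (F i)) -> wsos (\sum_i F i).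
Proof.
by move=> sF; elim/big_ind: _ => //; [exact: wsos0 | exact: wsosD].
Qed.

(* Lagrange's identity: twice the Gram determinant is the double sum of the    *)
(* squares [(a_i b_j - a_j b_i)^2], weighted by [m_i m_j].                     *)
Lemma wsos_cauchy_schwarz (I : finType) (m a b : I -> B) :
  (forall i, pos (m i)) ->
  wsos ((\sum_i m i * (a i * a i)) * (\sum_i m i * (b i * b i))
        - (\sum_i m i * (a i * b i)) ^+ 2).
Proof.
move=> pm; set S := _ - _.
have -> : S = iota 2^-1 * \sum_i \sum_j (m i * m j * (a i * b j - a j * b i) ^+ 2).
  have -> : \sum_i \sum_j (m i * m j * (a i * b j - a j * b i) ^+ 2) = S + S.
    transitivity (\sum_i \sum_j (m i * (a i * a i)) * (m j * (b j * b j))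
      + \sum_i \sum_j (m j * (a j * a j)) * (m i * (b i * b i))
      - \sum_i \sum_j (m i * (a i * b i)) * (m j * (a j * b j)) *+ 2).
      rewrite -big_split -sumrB; apply: eq_bigr => i _.
      by rewrite -big_split -sumrB; apply: eq_bigr => j _ /=; ring.
    rewrite [X in _ + X - _]exchange_big /=.
    under [X in _ - X]eq_bigr do rewrite sumrMnl.
    rewrite sumrMnl -!big_distrlr /= /S; ring.
  have -> : S + S = iota 2%:R * S by rewrite rmorph_nat; ring.
  by rewrite mulrA -rmorphM mulVf ?rmorph1 ?mul1r // pnatr_eq0.
apply: wsos_scale; first by rewrite invr_ge0 ler0n.
apply: wsos_sum => i; apply: wsos_sum => j.
by apply: wsosZ; [exact: posM | exact: wsos_sqr].
Qed.

Variables (n : nat) (g : rel 'I_n.+1) (w : 'I_n.+1 -> B).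
Hypothesis w1 : \sum_v w v = 1.
Hypothesis pos_w : forall v, pos (w v).

Lemma pos_prod (I : finType) (chi : {ffun I -> 'I_n.+1}) :
  pos (\prod_i w (chi i)).
Proof.
by elim/big_ind: _ => //; rewrite -(rmorph1 iota); apply: pos_iota; exact: ltr01.
Qed.

Lemma CS_sound f phi : CS f -> wsos (evA iota g w f phi).
Proof.
move=> csf; elim: csf phi => {f}.
- by move=> f1 f2 _ IH E phi; rewrite -(evA_eqA iota g w1 phi E).
- by move=> f phi; rewrite evA_mul // -expr2; exact: wsos_sqr.
- move=> L T f1 f2 _ _ _ phi.
  (* A common bound makes the three averages sums over the same [chi], as Lagrange's identity
     requires. *)
  pose N := maxn (label_bound (mulA f1 f1))
    (maxn (label_bound (mulA f2 f2)) (label_bound (mulA f1 f2))).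
  have unl h1 h2 : (label_bound (mulA h1 h2) <= N)%N ->
      evA iota g w (unlA T (mulA h1 h2)) phi
      = \sum_(chi : {ffun 'I_N -> 'I_n.+1}) (\prod_i w (chi i)) *
          (evA iota g w h1 (resample T phi chi) * evA iota g w h2 (resample T phi chi)).
    by move=> hN; rewrite (evA_unl _ _ w1 _ _ hN); apply: eq_avg => chi; rewrite evA_mul.
  rewrite evA_sub !evA_mul // -expr2 !unl ?leq_max ?leqnn ?orbT //.
  by apply: wsos_cauchy_schwarz => chi; exact: pos_prod.
- move=> f1 f2 a b a0 b0 _ IH1 _ IH2 phi; rewrite evA_add !evA_scale.
  by apply: wsosD; exact: wsos_scale.
- by move=> f1 f2 _ IH1 _ IH2 phi; rewrite evA_mul //; exact: wsosM.
- move=> T f _ IH phi; rewrite (evA_unl _ _ w1 _ _ (leqnn _)).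
  by apply: wsos_sum => chi; apply: wsosZ; [exact: pos_prod | exact: IH].
Qed.

End Soundness.

(** * The Motzkin polynomial *)

Definition formally_real (C : comNzRingType) (kappa : R -> C) :=
  forall r : seq (R * C), all (fun p : R * C => 0 < p.1) r ->
    \sum_(p <- r) kappa p.1 * p.2 ^+ 2 = 0 -> all (fun p => p.2 == 0) r.

Lemma formally_real_R : formally_real (fun x : R => x).
Proof.
move=> r /allP rpos /eqP; rewrite big_seq psumr_eq0; last first.
  by move=> p pr; rewrite mulr_ge0 ?sqr_ge0 // ltW ?rpos.
move=> /allP z; apply/allP => p pr; have := z p pr; rewrite pr /=.
by rewrite mulf_eq0 sqrf_eq0 gt_eqF ?rpos.
Qed.

Section FormallyRealPoly.
Variables (C : comNzRingType) (kappa : R -> C).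
Hypothesis frC : formally_real kappa.

Lemma coef_sqr_top (h : {poly C}) k :
  (size h <= k.+1)%N -> (h ^+ 2)`_(k.*2) = h`_k ^+ 2.
Proof.
move=> hk; rewrite expr2 coefM.
have kk : (k < k.*2.+1)%N by lia.
rewrite (bigD1 (Ordinal kk)) //= big1 ?addr0 => [|j jk].
  by rewrite expr2; congr (_ * h`_ _); lia.
have [kj|jk'] := ltnP k j; first by rewrite nth_default ?mul0r // (leq_trans hk).
rewrite [X in _ * X]nth_default ?mulr0 //; apply: leq_trans hk _.
have : (j : nat) != k by apply: contraNneq jk => E; apply/eqP/val_inj.
by lia.
Qed.

(** Top coefficients cannot cancel: their squares would form a vanishing positive combination in
    [C]. The excess [k] over [d] is lowered one step at a time. *)
Lemma sos_size (r : seq (R * {poly C})) d : all (fun p : R * {poly C} => 0 < p.1) r ->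
  (size (\sum_(p <- r) (kappa p.1)%:P * p.2 ^+ 2)%R <= d.*2.+1)%N ->
  all (fun p : R * {poly C} => size p.2 <= d.+1)%N r.
Proof.
move=> rpos sz.
have [k] : exists k, all (fun p : R * {poly C} => size p.2 <= (k + d).+1)%N r.
  exists (\max_(p <- r) size p.2)%N; apply/allP => p pr.
  rewrite -addnS; apply: leq_trans (leq_addr _ _).
  by rewrite (big_rem p) //= leq_maxl.
elim: k => [|k IH] // rk; apply: IH; set e := (k.+1 + d)%N in rk.
have : all (fun p => p.2 == 0) [seq (p.1, p.2`_e) | p : R * {poly C} <- r].
  apply: frC; first by rewrite all_map; exact: sub_all rpos.
  rewrite big_map /=; transitivity ((\sum_(p <- r) (kappa p.1)%:P * p.2 ^+ 2)`_(e.*2)).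
    rewrite coef_sum big_seq [RHS]big_seq; apply: eq_bigr => p pr.
    by rewrite coefCM coef_sqr_top // (allP rk).
  by rewrite nth_default //; apply: leq_trans sz _; rewrite /e; lia.
rewrite all_map => /allP z; apply/allP => p pr.
have /eqP pe := z p pr; have := allP rk p pr; rewrite leq_eqVlt => /predU1P[E|]; last first.
  by rewrite /e; lia.
have : lead_coef p.2 = 0 by rewrite lead_coefE E.
by move/eqP; rewrite lead_coef_eq0 => /eqP p0; move: E; rewrite p0 size_poly0.
Qed.

Lemma formally_real_poly : formally_real (fun x : R => (kappa x)%:P).
Proof.
move=> r rpos z.
have sz : all (fun p : R * {poly C} => size p.2 <= 1)%N r.
  by apply: (@sos_size _ 0) => //; rewrite z size_poly0.
have : all (fun p => p.2 == 0) [seq (p.1, p.2`_0) | p : R * {poly C} <- r].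
  apply: frC; first by rewrite all_map; exact: sub_all rpos.
  rewrite big_map /= -[RHS](coef0 _ 0) -z coef_sum big_seq [RHS]big_seq.
  by apply: eq_bigr => p pr; rewrite coefCM -(@coef_sqr_top _ 0) // (allP sz).
rewrite all_map => /allP z0; apply/allP => p pr.
by have /eqP /= p0 := z0 p pr; rewrite (size1_polyC (allP sz p pr)) p0.
Qed.

End FormallyRealPoly.

Definition kappa2 (x : R) : {poly {poly R}} := x%:P%:P.

Lemma formally_real_kappa2 : formally_real kappa2.
Proof. exact/formally_real_poly/formally_real_poly/formally_real_R. Qed.

Definition motzkin (C : comNzRingType) (a b c : C) : C :=
  a ^+ 4 * b ^+ 2 + a ^+ 2 * b ^+ 4 - 3 * (a ^+ 2 * b ^+ 2 * c ^+ 2) + c ^+ 6.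

Lemma rmorph_motzkin (C D : comNzRingType) (h : {rmorphism C -> D}) a b c :
  h (motzkin a b c) = motzkin (h a) (h b) (h c).
Proof. by rewrite /motzkin; ring. Qed.

Lemma motzkin_ge0 (a b c : R) : 0 <= motzkin a b c.
Proof.
set p := `|a| * `|b|.
have p0 : 0 <= p by rewrite mulr_ge0.
(* The absolute values make [p] nonnegative; they also keep this identity from being a polynomial
   sum of squares. *)
have -> : motzkin a b c = p ^+ 2 * (`|a| - `|b|) ^+ 2 + (c ^+ 2 - p) ^+ 2 * (c ^+ 2 + p *+ 2).
  have ea : a ^+ 2 = `|a| ^+ 2 by rewrite real_normK ?num_real.
  have eb : b ^+ 2 = `|b| ^+ 2 by rewrite real_normK ?num_real.
  have -> : motzkin a b c = a ^+ 2 ^+ 2 * b ^+ 2 + a ^+ 2 * b ^+ 2 ^+ 2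
     - 3 * (a ^+ 2 * b ^+ 2 * c ^+ 2) + c ^+ 6 by rewrite /motzkin; ring.
  by rewrite ea eb /p; ring.
by rewrite addr_ge0 // mulr_ge0 ?sqr_ge0 // addr_ge0 ?sqr_ge0 // mulrn_wge0.
Qed.

(* Comparing coefficients of [x]: the constant terms are constants, the        *)
(* coefficients of [x^2] are multiples of [y], and then the coefficient of     *)
(* [x^2] of the sum at [y = 1] and [y = -1] adds up to [-4 < 0].               *)
Lemma motzkin_not_sos (r : seq (R * {poly {poly R}})) :
  all (fun p : R * {poly {poly R}} => 0 < p.1) r ->
  \sum_(p <- r) kappa2 p.1 * p.2 ^+ 2 <> motzkin 'X 'X%:P 1.
Proof.
move=> rpos E.
have EM : motzkin 'X 'X%:P 1 = 1%:P + ('X ^+ 4 - 'X ^+ 2 *+ 3)%:P * 'X^2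
    + ('X ^+ 2)%:P * 'X^4 :> {poly {poly R}}.
  by rewrite /motzkin polyCB polyCMn !polyC_exp polyC1; ring.
have coefm k : (motzkin 'X 'X%:P 1 : {poly {poly R}})`_k =
    (k == 0)%:R + ('X ^+ 4 - 'X ^+ 2 *+ 3) *+ (k == 2) + 'X ^+ 2 *+ (k == 4).
  rewrite EM !coefD !coefCM !coefXn coefC !mulr_natr.
  by case: (k == 0).
have sz : all (fun p : R * {poly {poly R}} => size p.2 <= 3)%N r.
  apply: (sos_size (formally_real_poly formally_real_R)) => //.
  rewrite -/kappa2 E; apply/leq_sizeP => k k5; rewrite coefm.
  by rewrite !gtn_eqF ?mulr0n ?addr0 //; lia.
have cf k F : (forall p, p \in r -> (p.2 ^+ 2)`_k = F p.2) ->
    \sum_(p <- r) p.1%:P * F p.2 =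
      (k == 0)%:R + ('X ^+ 4 - 'X ^+ 2 *+ 3) *+ (k == 2) + 'X ^+ 2 *+ (k == 4).
  move=> H; rewrite -coefm -E coef_sum big_seq [RHS]big_seq.
  by apply: eq_bigr => p pr; rewrite /kappa2 coefCM H.
have c0 : \sum_(p <- r) p.1%:P * p.2`_0 ^+ 2 = 1.
  rewrite (cf 0%N (fun h : {poly {poly R}} => h`_0 ^+ 2)) /= ?mulr0n ?addr0 // => p _.
  by rewrite expr2 coef0M.
have c4 : \sum_(p <- r) p.1%:P * p.2`_2 ^+ 2 = 'X ^+ 2.
  rewrite (cf 4%N (fun h : {poly {poly R}} => h`_2 ^+ 2)) /= ?mulr0n ?add0r // => p pr.
  by rewrite -[4%N]/(2.*2)%N coef_sqr_top // (allP sz).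
have c2 : \sum_(p <- r) p.1%:P * (p.2`_1 ^+ 2 + p.2`_0 * p.2`_2 *+ 2) = 'X ^+ 4 - 'X ^+ 2 *+ 3.
  rewrite (cf 2%N (fun h : {poly {poly R}} => h`_1 ^+ 2 + h`_0 * h`_2 *+ 2))
    /= ?mulr0n ?add0r ?addr0 // => p pr.
  by rewrite expr2 coefM !big_ord_recl big_ord0 /=; ring.
have sz0 : all (fun p : R * {poly {poly R}} => size (p.2`_0)%R <= 1)%N r.
  have := @sos_size _ _ formally_real_R [seq (p.1, p.2`_0) | p : R * {poly {poly R}} <- r] 0.
  rewrite !all_map big_map /= c0 size_poly1; apply=> //.
have sz2 : all (fun p : R * {poly {poly R}} => size (p.2`_2)%R <= 2)%N r.
  have := @sos_size _ _ formally_real_R [seq (p.1, p.2`_2) | p : R * {poly {poly R}} <- r] 1.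
  rewrite !all_map big_map /= c4 size_polyXn; apply=> //.
have z2 : all (fun p : R * {poly {poly R}} => p.2`_2`_0 == 0) r.
  have := @formally_real_R [seq (p.1, p.2`_2`_0) | p : R * {poly {poly R}} <- r].
  rewrite !all_map big_map /=; apply=> //.
  have /(congr1 (fun q : {poly R} => q`_0)) := c4; rewrite coef_sum coefXn /= => c40.
  apply: etrans _ c40.
  by apply: eq_bigr => p _; rewrite coefCM !expr2 coef0M.
(* The cross term is a constant times a multiple of y, hence odd in y: adding the values at 1 and -1
   cancels it. *)
have : \sum_(p <- r) p.1 * ((p.2`_1).[1] ^+ 2 + (p.2`_1).[-1] ^+ 2) = - 4.
  have /(congr1 (fun q : {poly R} => q.[1] + q.[-1])) := c2.
  rewrite !horner_sum -big_split /= => E2.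
  transitivity (('X ^+ 4 - 'X ^+ 2 *+ 3 : {poly R}).[1]
    + ('X ^+ 4 - 'X ^+ 2 *+ 3 : {poly R}).[-1]); last first.
    by rewrite !(hornerD, hornerN, hornerMn, hornerXn); ring.
  rewrite -E2 big_seq [RHS]big_seq; apply: eq_bigr => p pr.
  have -> : p.2`_0 = (p.2`_0`_0)%:P by apply: size1_polyC; exact: (allP sz0).
  have -> : p.2`_2 = (p.2`_2`_1)%:P * 'X.
    apply/polyP => -[|[|k]]; rewrite coefMX coefC //=; first exact/eqP/(allP z2).
    by rewrite nth_default //; apply: leq_trans (allP sz2 p pr) _.
  by rewrite !(hornerD, hornerM, hornerMn, hornerC, hornerX, horner_exp) /=; ring.
apply/eqP; rewrite gt_eqF //; apply: (@lt_le_trans _ _ 0); first by lra.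
rewrite big_seq; apply: sumr_ge0 => p pr.
by rewrite mulr_ge0 ?addr_ge0 ?sqr_ge0 // ltW // (allP rpos).
Qed.

(** * Lowest coefficients of weighted sums of squares *)

Definition pos0 (m : {poly {poly {poly R}}}) : Prop :=
  exists2 c, 0 < c & m.[0] = kappa2 c.

Lemma pos0M a b : pos0 a -> pos0 b -> pos0 (a * b).
Proof.
move=> [c c0 ac] [d d0 bd]; exists (c * d); first exact: mulr_gt0.
by rewrite hornerM ac bd /kappa2 !polyCM.
Qed.

(** Records the value of each weight at s = 0, the positive real to which formal reality applies. *)
Lemma wsos_pos0_seq F : wsos pos0 F ->
  exists r : seq (R * ({poly {poly {poly R}}} * {poly {poly {poly R}}})),
    all (fun p => (0 < p.1) && (p.2.1.[0] == kappa2 p.1)) r /\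
    F = \sum_(p <- r) p.2.1 * p.2.2 ^+ 2.
Proof.
elim=> [|m g F' [c c0 mc] _ [r [rp ->]]]; first by exists [::]; rewrite big_nil.
by exists ((c, (m, g)) :: r); rewrite big_cons /= c0 mc eqxx.
Qed.

(* A factor [s^2] forces every summand to vanish at [s = 0].                   *)
Lemma wsos_lowest F k G : wsos pos0 F -> F = 'X^(k.*2) * G ->
  exists r : seq (R * {poly {poly R}}), all (fun p => 0 < p.1) r /\
    \sum_(p <- r) kappa2 p.1 * p.2 ^+ 2 = G.[0].
Proof.
move=> /wsos_pos0_seq[r [rp ->]].
have at0 (q : seq (R * ({poly {poly {poly R}}} * {poly {poly {poly R}}}))) :
    all (fun p => (0 < p.1) && (p.2.1.[0] == kappa2 p.1)) q ->
    \sum_(p <- [seq (p.1, p.2.2.[0]) | p <- q]) kappa2 p.1 * p.2 ^+ 2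
    = (\sum_(p <- q) p.2.1 * p.2.2 ^+ 2).[0].
  move=> /allP qp; rewrite horner_sum big_map big_seq [RHS]big_seq.
  apply: eq_bigr => p pq; rewrite hornerM horner_exp.
  by have /andP[_ /eqP ->] := qp p pq.
have pos1 (q : seq (R * ({poly {poly {poly R}}} * {poly {poly {poly R}}}))) :
    all (fun p => (0 < p.1) && (p.2.1.[0] == kappa2 p.1)) q ->
    all (fun p : R * {poly {poly R}} => 0 < p.1) [seq (p.1, p.2.2.[0]) | p <- q].
  by rewrite all_map; apply: sub_all => p /andP[].
elim: k r rp => [|k IH] r rp E.
  exists [seq (p.1, p.2.2.[0]) | p <- r]; split; first exact: pos1.
  by rewrite at0 // E mul1r.
have z : all (fun p => p.2 == 0) [seq (p.1, p.2.2.[0]) | p <- r].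
  apply: (formally_real_kappa2 (pos1 _ rp)).
  by rewrite at0 // E hornerM hornerXn expr0n mul0r.
(* Each squared polynomial vanishes at s = 0, so it is divided by s; the weights are kept. *)
pose r' := [seq (p.1, (p.2.1, drop_poly 1 p.2.2)) | p <- r].
apply: (IH r'); first by rewrite all_map.
apply: (mulfI (_ : 'X^2 != 0)); first by rewrite -size_poly_eq0 size_polyXn.
rewrite mulrA -exprD -[(2 + _)%N]/(k.+1.*2) -E big_map mulr_sumr.
rewrite big_seq [RHS]big_seq; apply: eq_bigr => p pr /=.
move: z; rewrite all_map => /allP /(_ p pr) /eqP /= p0.
rewrite -[in RHS](poly_take_drop 1 p.2.2).
have -> : take_poly 1 p.2.2 = 0.
  apply/polyP => -[|i]; rewrite coef_take_poly coef0 //=.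
  by rewrite -horner_coef0.
by rewrite add0r expr1 exprMn; ring.
Qed.

(** * The Motzkin form of star densities *)

Definition constA (c : R) : comb := [:: (c, gempty)].

(** An edge rooted at label 0. Its powers glue edges at the root, so unlabeling them gives stars. *)
Definition degreeA : comb :=
  [:: (1, PLG [:: 0%N] 1 (fun x y => if x is inl _ then true else false))].

Definition star1 : comb := unlA [::] degreeA.
Definition star2 : comb := unlA [::] (mulA degreeA degreeA).
Definition star3 : comb := unlA [::] (mulA degreeA (mulA degreeA degreeA)).

Definition motzkinA (a b c : comb) : comb :=
  let a2 := mulA a a in let b2 := mulA b b in let c2 := mulA c c in
  addA (subA (addA (mulA (mulA a2 a2) b2) (mulA a2 (mulA b2 b2)))
             (scaleA 3 (mulA (mulA a2 b2) c2)))
       (mulA c2 (mulA c2 c2)).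

Section EvaluationExamples.
Variables (B : comNzRingType) (iota : {rmorphism R -> B}).
Variables (n : nat) (w : 'I_n.+1 -> B).
Hypothesis w1 : \sum_v w v = 1.

Lemma evA_const g c phi : evA iota g w (constA c) phi = iota c.
Proof.
rewrite /evA big_seq1 /ev (eq_avg _ (_ : _ =1 fun=> 1)) ?avg_cst ?mulr1 // => psi.
by rewrite (_ : homb _ _ _) //; apply/asboolP => -[?|?] [?|?] /and4P[].
Qed.

Lemma evA_motzkin g a b c phi : evA iota g w (motzkinA a b c) phi =
  motzkin (evA iota g w a phi) (evA iota g w b phi) (evA iota g w c phi).
Proof.
rewrite evA_add evA_sub evA_add evA_scale !evA_mul // /motzkin.
by rewrite rmorph_nat; ring.
Qed.

Lemma avg_ord1 (F : {ffun 'I_1 -> 'I_n.+1} -> B) :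
  avg w F = \sum_v w v * F [ffun=> v].
Proof.
rewrite /avg (reindex (fun v => [ffun _ : 'I_1 => v])) /=.
  by apply: eq_bigr => v _; rewrite big_ord1 ffunE.
exists (fun c : {ffun 'I_1 -> 'I_n.+1} => c ord0) => [v _ | c _]; first by rewrite ffunE.
by apply/ffunP => i; rewrite ffunE (ord1 i).
Qed.

(** For [eq_op] the only neighbor of a vertex is itself, so its degree is its own weight; this turns
    star densities into power sums. *)
Lemma evA_degree phi : evA iota eq_op w degreeA phi = w (phi 0%N).
Proof.
rewrite /evA big_seq1 /= rmorph1 mul1r /ev avg_ord1 (bigD1 (phi 0%N)) //= big1 => [|v nv].
  rewrite addr0 (_ : homb _ _ _) ?mulr1 //; apply/asboolP.
  case=> [x|i] [y|j] /and4P[] //=; rewrite ?inE.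
  - by move=> /eqP -> /eqP ->.
  - by move=> /eqP -> lt _ _; rewrite insubT ffunE.
  - by move=> lt /eqP -> _ _; rewrite insubT ffunE.
rewrite (_ : homb _ _ _ = false) ?mulr0 //; apply/asboolP => h.
have := h (inl 0%N) (inr 0%N) isT; rewrite /assign insubT ffunE => /eqP E.
by rewrite E eqxx in nv.
Qed.

Lemma evA_star1 phi : evA iota eq_op w star1 phi = \sum_v w v ^+ 2.
Proof.
rewrite (@evA_unl _ _ _ _ _ w1 _ 1); last by rewrite /label_bound unlock.
rewrite avg_ord1; apply: eq_bigr => v _.
by rewrite evA_degree /resample /= insubT ffunE expr2.
Qed.

Lemma evA_star2 phi : evA iota eq_op w star2 phi = \sum_v w v ^+ 3.
Proof.
rewrite (@evA_unl _ _ _ _ _ w1 _ 1); last by rewrite /label_bound unlock.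
rewrite avg_ord1; apply: eq_bigr => v _.
by rewrite evA_mul // evA_degree /resample /= insubT ffunE; ring.
Qed.

Lemma evA_star3 phi : evA iota eq_op w star3 phi = \sum_v w v ^+ 4.
Proof.
rewrite (@evA_unl _ _ _ _ _ w1 _ 1); last by rewrite /label_bound unlock.
rewrite avg_ord1; apply: eq_bigr => v _.
by rewrite !evA_mul // evA_degree /resample /= insubT ffunE; ring.
Qed.

End EvaluationExamples.

Lemma tH_ev H n (g : rel 'I_n.+1) phi :
  tH H g phi = ev g (fun=> n.+1%:R^-1 : R) H phi.
Proof.
rewrite /tH /ev /avg -sum1_card natr_sum mulr_suml.
rewrite big_mkcond; apply: eq_bigr => psi _ /=.
rewrite big_const_ord iter_mulr_1 exprVn natrX inE.
by rewrite /homb /is_hom; case: asboolP => _; rewrite ?mulr1 ?mulr0 ?mul1r.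
Qed.

Lemma tA_evA f n (g : rel 'I_n.+1) phi :
  tA f g phi = evA idfun g (fun=> n.+1%:R^-1 : R) f phi.
Proof. by apply: eq_bigr => p _; rewrite tH_ev. Qed.

Lemma positive_motzkinA a b c : positive (motzkinA a b c).
Proof.
move=> n g _ _ phi; rewrite tA_evA evA_motzkin ?motzkin_ge0 //.
by rewrite sumr_const card_ord -[LHS]mulr_natr mulVf // pnatr_eq0.
Qed.

(* The constant is the density of the star with [k] edges at weights           *)
(* 1/10, .., 4/10, where the model is based at [s = 0].                        *)
Definition centered (k : nat) (f : comb) : comb :=
  scaleA (10 ^+ k / (6 * k.+1%:R))
    (subA f (constA (\sum_(v < 4) ((v.+1)%:R / 10) ^+ k.+1))).

Definition motzkin_star : comb :=
  motzkinA (centered 1 star1) (centered 2 star2) (centered 3 star3).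

(** * The model on four looped vertices *)

Section Model.
Variables (C : comNzRingType) (kappa : {rmorphism R -> C}) (x y : C).

(* The dual basis, up to the factor 6, of the moments of order 1, 2, 3 on the  *)
(* points 1, 2, 3, 4: the sums of [(v + 1) ^ k * direction v] for k = 0, .., 3 *)
(* are 0, 6 x, 6 y and 6.                                                      *)
Definition direction (v : 'I_4) : C :=
  nth 0 [:: - 26 * x + 9 * y - 1; 57 * x - 24 * y + 3;
            - 42 * x + 21 * y - 3; 11 * x - 6 * y + 1] v.

(** Four distinct points let the moments of order 0 to 3 be prescribed independently: order 0 keeps
    the total mass at 1, the others carry x, y and 1. *)
Definition base (v : 'I_4) : C := (v.+1)%:R * kappa 10^-1.

Definition weight (v : 'I_4) : {poly C} := (base v)%:P + 'X * (direction v)%:P.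

Lemma baseE v : base v = kappa ((v.+1)%:R / 10).
Proof. by rewrite rmorphM rmorph_nat. Qed.

Lemma direction_moment0 : \sum_v direction v = 0.
Proof. by rewrite !big_ord_recl big_ord0 /direction /=; ring. Qed.

Lemma direction_moment1 :
  \sum_v base v * direction v = 6 * kappa 10^-1 * x.
Proof. by rewrite !big_ord_recl big_ord0 /base /direction /= /bump /=; ring. Qed.

Lemma direction_moment2 :
  \sum_v base v ^+ 2 * direction v = 6 * kappa 10^-1 ^+ 2 * y.
Proof. by rewrite !big_ord_recl big_ord0 /base /direction /= /bump /=; ring. Qed.

Lemma direction_moment3 :
  \sum_v base v ^+ 3 * direction v = 6 * kappa 10^-1 ^+ 3.
Proof. by rewrite !big_ord_recl big_ord0 /base /direction /= /bump /=; ring. Qed.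

Lemma base_sum : \sum_v base v = 1.
Proof.
transitivity (10%:R * kappa 10^-1).
  by rewrite !big_ord_recl big_ord0 /base /= /bump /=; ring.
by rewrite -(rmorph_nat kappa) -rmorphM mulfV ?rmorph1 // pnatr_eq0.
Qed.

Lemma weight_sum : \sum_v weight v = 1.
Proof.
rewrite big_split -mulr_sumr -!(rmorph_sum polyC) /=.
by rewrite base_sum direction_moment0 polyC0 mulr0 addr0.
Qed.

Lemma poly_order1 (p : {poly C}) :
  exists2 u : {poly C}, p = p.[0]%:P + 'X * u & u.[0] = p^`().[0].
Proof.
exists (drop_poly 1 p); last first.
  by rewrite !horner_coef0 coef_drop_poly coef_deriv mulr1n.
rewrite -[LHS](poly_take_drop 1) expr1 mulrC; congr (_ + _).
apply/polyP => -[|i]; rewrite coef_take_poly coefC //=.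
by rewrite horner_coef0.
Qed.

Lemma weight_power k : exists2 u : {poly C},
  \sum_v weight v ^+ k.+1 = (\sum_v base v ^+ k.+1)%:P + 'X * u &
  u.[0] = (\sum_v base v ^+ k * direction v) *+ k.+1.
Proof.
have w0 v : (weight v).[0] = base v.
  by rewrite hornerD hornerM hornerX mul0r addr0 hornerC.
have [u E u0] := poly_order1 (\sum_v weight v ^+ k.+1).
exists u; last rewrite u0.
  rewrite [LHS]E; congr (_%:P + _).
  by rewrite horner_sum; apply: eq_bigr => v _; rewrite horner_exp w0.
rewrite (raddf_sum (@deriv C)) horner_sum -sumrMnl; apply: eq_bigr => v _.
rewrite /= deriv_exp hornerMn hornerM horner_exp w0 mulrC /= derivD derivM derivX !derivC.
by rewrite mulr0 addr0 add0r mul1r hornerC.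
Qed.

Let iota : {rmorphism R -> {poly C}} := polyC \o kappa.

(** Centering removes the constant term. The scalar in [centered] cancels the exponent [k.+1] from
    differentiation and the factor 6 / 10^k of the moment. *)
Lemma centered_order1 k f phi (z : C) :
  evA iota eq_op weight f phi = \sum_v weight v ^+ k.+1 ->
  \sum_v base v ^+ k * direction v = 6 * kappa 10^-1 ^+ k * z ->
  exists2 u : {poly C},
    evA iota eq_op weight (centered k f) phi = 'X * u & u.[0] = z.
Proof.
move=> fE dE; have [u uE u0] := weight_power k; pose a : R := 10 ^+ k / (6 * k.+1%:R).
exists (iota a * u).
  rewrite evA_scale evA_sub evA_const ?weight_sum // fE uE.
  have -> : iota (\sum_(v < 4) ((v.+1)%:R / 10) ^+ k.+1)
      = (\sum_v base v ^+ k.+1)%:P.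
    congr _%:P; rewrite rmorph_sum; apply: eq_bigr => v _.
    by rewrite baseE rmorphXn.
  by rewrite -/a; ring.
rewrite hornerM hornerC u0 dE -mulr_natr.
have aK : kappa a * (6%:R * kappa 10^-1 ^+ k * k.+1%:R) = 1.
  rewrite -!(rmorph_nat kappa) -rmorphXn -!rmorphM -[RHS](rmorph1 kappa).
  congr (kappa _); rewrite /a exprVn; field.
  by rewrite nat1r expf_neq0 ?pnatr_eq0.
transitivity (kappa a * (6%:R * kappa 10^-1 ^+ k * k.+1%:R) * z); first by ring.
by rewrite aK mul1r.
Qed.

Lemma motzkin_star_order6 phi : exists2 G : {poly C},
  evA iota eq_op weight motzkin_star phi = 'X^6 * G & G.[0] = motzkin x y 1.
Proof.
have w1 := weight_sum.
have [u1 E1 h1] := @centered_order1 1 star1 phi x (evA_star1 _ w1 _) direction_moment1.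
have [u2 E2 h2] := @centered_order1 2 star2 phi y (evA_star2 _ w1 _) direction_moment2.
have [u3 E3 h3] := @centered_order1 3 star3 phi 1 (evA_star3 _ w1 _)
  (etrans direction_moment3 (esym (mulr1 _))).
exists (motzkin u1 u2 u3); last first.
  by rewrite -[LHS]/(horner_eval 0 _) rmorph_motzkin /= /horner_eval h1 h2 h3.
by rewrite evA_motzkin // E1 E2 E3 /motzkin; ring.
Qed.

End Model.

Lemma motzkin_star_not_CS : ~ CS motzkin_star.
Proof.
pose kappa : {rmorphism R -> {poly {poly R}}} := polyC \o polyC.
pose iota : {rmorphism R -> {poly {poly {poly R}}}} := polyC \o kappa.
pose w := weight kappa 'X 'X%:P; pose phi (_ : nat) : 'I_4 := ord0.
have pos_iota a : 0 < a -> pos0 (iota a).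
  by move=> a0; exists a; rewrite //= hornerC.
have pos_w v : pos0 (w v).
  exists ((v.+1)%:R / 10); first by rewrite divr_gt0 ?ltr0n.
  by rewrite hornerD hornerM hornerX mul0r addr0 hornerC baseE.
have w1 : \sum_v w v = 1 by exact: weight_sum.
move=> /(CS_sound pos0M pos_iota eq_op w1 pos_w phi) S.
have [G E G0] := motzkin_star_order6 kappa 'X 'X%:P phi.
(* Here 3 is half the order 6 of the value in s. *)
have [r [rpos rE]] := @wsos_lowest _ 3 _ S E.
by apply: (motzkin_not_sos rpos); rewrite rE G0.
Qed.

Theorem theorem2p7 :
  exists f : comb, inFL [::] f /\ positive f /\ ~ CS_positive f.
Proof.
exists motzkin_star; split; first by [].
by split; [exact: positive_motzkinA | exact: motzkin_star_not_CS].
Qed.
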